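(* Let $f:\mathbb{R}^{m\times n}\to\mathbb{R}$ be a differentiable convex function, $t>0$ and $\varepsilon>0$, and consider the max-norm regularized problem $$\min_{Z\in\mathbb{R}^{m\times n},\ \|Z\|_{\max}\le t}f(Z).$$ After $\left\lceil\frac{8C_f}{\varepsilon}\right\rceil$ many iterations, the algorithm ''Max-Norm Regularized Solver'' obtains a solution that is $\varepsilon$-close to the optimum of this problem, i.e. a feasible $Z$ with $f(Z)$ at most $\varepsilon$ above the optimal value.
   Context: The max-norm of $Z\in\mathbb{R}^{m\times n}$ is $$\|Z\|_{\max}:=\min_{LR^T=Z}\max\{\|L\|_{2,\infty}^2,\|R\|_{2,\infty}^2\},$$ over all factorizations with $L\in\mathbb{R}^{m\times k}$, $R\in\mathbb{R}^{n\times k}$ and $k$ unconstrained, where $\|L\|_{2,\infty}$ is the maximum Euclidean norm of a row of $L$. Let $\mathbb{S}^{N\times N}$ be the symmetric real $N\times N$ matrices with Frobenius inner product $A\bullet B=\mathrm{Tr}(A^TB)$. Writing $X\in\mathbb{S}^{(m+n)\times(m+n)}$ in blocks as $X=\begin{pmatrix}V&Z\\Z^T&W\end{pmatrix}$ with $Z\in\mathbb{R}^{m\times n}$ the upper right block, set $\hat f(X):=f(Z)$ and $F(X):=\hat f(tX)$. Let $\boxplus:=\{X\in\mathbb{S}^{(m+n)\times(m+n)} : X\succeq0,\ X_{ii}\le1\ \forall i\}$. $C_f$ in the claim denotes the curvature constant of the function to which the algorithm is applied, namely $$C_f:=\sup_{\substack{X,S\in\boxplus,\ \alpha\in(0,1],\\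 Y=X+\alpha(S-X)}}\frac{1}{\alpha^2}\bigl(F(Y)-F(X)-(Y-X)\bullet\nabla F(X)\bigr),$$ assumed finite and positive. Algorithm ''Max-Norm Regularized Solver'': set $X^{(0)}:=vv^T$ for an arbitrary unit vector $v\in\mathbb{R}^{m+n}$. For $k=0,1,2,\dots$: let $\alpha:=\frac{2}{k+2}$; compute any $S\in\boxplus$ with $S\bullet\nabla F(X^{(k)})\le\min_{Y\in\boxplus}Y\bullet\nabla F(X^{(k)})+\alpha C_f$; update $X^{(k+1)}:=X^{(k)}+\alpha(S-X^{(k)})$. The solution obtained after $k$ iterations is the upper right $m\times n$ block $Z$ of $tX^{(k)}$. *)

(* Defs.v *)
From HB Require Import structures.
From mathcomp Require Import all_boot all_order all_algebra.
From mathcomp Require Import all_classical all_reals all_analysis.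

Set Implicit Arguments.
Unset Strict Implicit.
Unset Printing Implicit Defensive.
Import Order.TTheory GRing.Theory Num.Theory.
Import numFieldNormedType.Exports.
Local Open Scope classical_set_scope.
Local Open Scope ring_scope.

Definition row_norm (R : realType) (m k : nat) (L : 'M[R]_(m, k)) (i : 'I_m) : R :=
  Num.sqrt (\sum_(j < k) L i j ^+ 2).

Definition norm2oo (R : realType) (m k : nat) (L : 'M[R]_(m, k)) : R :=
  \big[Num.max/0]_(i < m) row_norm L i.

(* The inner dimension k is unconstrained.  The set of values is nonempty and
   bounded below by 0, so that [inf] is a genuine infimum; it is attained, by
   compactness. *)
Definition max_norm (R : realType) (m n : nat) (Z : 'M[R]_(m, n)) : R :=
  inf [set c | exists (k : nat) (L : 'M[R]_(m, k)) (P : 'M[R]_(n, k)),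
         L *m P^T = Z /\ c = Num.max (norm2oo L ^+ 2) (norm2oo P ^+ 2)].

Definition frob (R : realType) (p q : nat) (A B : 'M[R]_(p, q)) : R :=
  \tr (A^T *m B).

Definition psd (R : realType) (N : nat) (X : 'M[R]_N) : Prop :=
  forall v : 'cV[R]_N, 0 <= (v^T *m X *m v) 0 0.

Definition boxplus (R : realType) (N : nat) : set 'M[R]_N :=
  [set X | [/\ X^T = X, psd X & forall i, X i i <= 1]].
Arguments boxplus {R N}.

Definition sym_unit (R : realType) (N : nat) (i j : 'I_N) : 'M[R]_N :=
  2^-1 *: (delta_mx i j + delta_mx j i).

(* Gradient of G as a function on the Euclidean space of symmetric matrices
   with the Frobenius inner product; it only uses the values of G on symmetric
   matrices when X is symmetric.  See [sym_grad_sym] and [sym_gradP]. *)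
Definition sym_grad (R : realType) (N : nat) (G : 'M[R]_N -> R) (X : 'M[R]_N) :
    'M[R]_N :=
  \matrix_(i, j) 'D_(sym_unit R i j) G X.

Lemma sym_grad_sym (R : realType) (N : nat) (G : 'M[R]_N -> R) (X : 'M[R]_N) :
  (sym_grad G X)^T = sym_grad G X.
Proof. by apply/matrixP => i j; rewrite !mxE /sym_unit addrC. Qed.

Lemma sym_gradP (R : realType) (N : nat) (G : 'M[R]_N -> R) (X H : 'M[R]_N) :
  differentiable G X -> H^T = H -> frob H (sym_grad G X) = 'D_H G X.
Proof.
move=> dG HT.
have HE : H = \sum_i \sum_j H i j *: sym_unit R i j.
  have E : H = \sum_i \sum_j H i j *: delta_mx i j by exact: matrix_sum_delta.
  have ET : H = \sum_i \sum_j H i j *: delta_mx j i.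
    rewrite -[LHS]HT {1}E raddf_sum; apply: eq_bigr => i _.
    rewrite raddf_sum; apply: eq_bigr => j _.
    by rewrite /= linearZ /= trmx_delta.
  transitivity (2^-1 *: (H + H)).
    by rewrite scalerDr -scalerDl -[2^-1]div1r -splitr scale1r.
  rewrite {1}E {2}ET -big_split scaler_sumr; apply: eq_bigr => i _ /=.
  rewrite -big_split scaler_sumr; apply: eq_bigr => j _ /=.
  by rewrite /sym_unit -scalerDr scalerA mulrC -scalerA.
rewrite deriveE// [in RHS]HE raddf_sum /frob /mxtrace.
under eq_bigr do rewrite mxE.
rewrite exchange_big; apply: eq_bigr => i _ /=.
rewrite raddf_sum; apply: eq_bigr => j _.
by rewrite /= linearZ /= !mxE deriveE.
Qed.

(* F (X) = fhat (t X), where fhat applies f to the upper right m x n block. *)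
Definition lift_obj (R : realType) (m n : nat) (f : 'M[R]_(m, n) -> R) (t : R)
    (X : 'M[R]_(m + n)) : R :=
  f (ursubmx (t *: X)).

Definition curvature (R : realType) (N : nat) (F : 'M[R]_N -> R) : \bar R :=
  ereal_sup [set e | exists (X S Y : 'M[R]_N) (alpha : R),
    [/\ boxplus X, boxplus S, 0 < alpha <= 1, Y = X + alpha *: (S - X) &
        e = ((alpha ^+ 2)^-1 *
             (F Y - F X - frob (Y - X) (sym_grad F X)))%:E]].

(* X k is the iterate after k iterations, S k the approximate minimizer of the
   linearized problem computed in iteration k. *)
Definition solver_run (R : realType) (m n : nat) (f : 'M[R]_(m, n) -> R)
    (t Cf : R) (X S : nat -> 'M[R]_(m + n)) : Prop :=
  (exists v : 'cV[R]_(m + n),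
     Num.sqrt (\sum_i v i 0 ^+ 2) = 1 /\ X 0%N = v *m v^T) /\
  forall k : nat,
    let alpha : R := 2 / k.+2%:R in
    let G := sym_grad (lift_obj f t) (X k) in
    [/\ boxplus (S k),
        frob (S k) G <= inf [set frob Y G | Y in boxplus] + alpha * Cf &
        X k.+1 = X k + alpha *: (S k - X k)].

Definition max_norm_ball (R : realType) (m n : nat) (t : R) : set 'M[R]_(m, n) :=
  [set Z | max_norm Z <= t].
Arguments max_norm_ball {R} m n t.

(* Main.v *)
Require Import Defs.
From HB Require Import structures.
From mathcomp Require Import all_boot all_order all_algebra.
From mathcomp Require Import all_classical all_reals all_analysis.
From mathcomp Require Import ring lra.

Set Implicit Arguments.
Unset Strict Implicit.
Unset Printing Implicit Defensive.
Import Order.TTheory GRing.Theory Num.Theory.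
Import numFieldNormedType.Exports.
Local Open Scope classical_set_scope.
Local Open Scope ring_scope.

(** The max-norm ball of radius t is the set of upper right blocks of t boxplus.
    A factorization Z = L *m P^T amounts to a Gram matrix of the stacked
    rows of L and P, whose upper right block is Z and whose diagonal lists the
    squared row norms.  Conversely a positive semidefinite matrix is a Gram
    matrix ([psd_factor], a Cholesky factorization), so its upper right block
    comes with a factorization whose row norms are read off the diagonal.  Hence
    every iterate gives a feasible Z ([boxplus_max_norm_ball]), and minimizing f
    over the ball is minimizing the lifted objective F over boxplus
    ([max_norm_lt_boxplus]).

    On boxplus the solver is the Frank-Wolfe method with inexact oracle.  With
    step a, the definition of the curvature constant C bounds F at the next
    iterate by F X + a <S - X, grad F X> + a^2 C; the oracle replaces S by any
    competitor Y at the price of a further a^2 C; and convexity gives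
    <Y - X, grad F X> <= F Y - F X ([lift_obj_first_order]).  So the gap
    h k = F (X k) - F Y obeys h (k+1) <= (1 - a) h k + 2 a^2 C, which for
    a = 2 / (k+2) forces h k <= 8 C / (k+2) for k >= 1 ([harmonic_rate]); this
    is at most eps once k >= 8 C / eps.

    The max-norm being an infimum, a matrix of max-norm at most t is known to be
    a block of a point of u boxplus only for u > t.  Instead of a compactness
    argument, the proof shrinks the competitor Z' to (1 - a) Z', which is a
    block of t boxplus, and lets a tend to 0, f ((1 - a) Z') being controlled by
    the convexity of f on the segment from Z' to 0. *)

(** * Positive semidefinite matrices *)

Section Psd.
Context {R : realType}.

Lemma psd_diag_ge0 N (X : 'M[R]_N) i : psd X -> 0 <= X i i.
Proof. by move=> /(_ (delta_mx i 0)); rewrite trmx_delta -rowE -colE !mxE. Qed.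

(** The 2 x 2 principal minor, as the discriminant of the form restricted to
    the span of two coordinate vectors. *)
Lemma psd_minor N (X : 'M[R]_N) i j :
  X^T = X -> psd X -> X i j ^+ 2 <= X i i * X j j.
Proof.
move=> XT Xpsd.
have entryE k l : (delta_mx 0 k *m X *m delta_mx l 0 : 'M[R]_1) 0 0 = X k l.
  by rewrite -rowE -colE !mxE.
have Xji : X j i = X i j by rewrite -[in LHS]XT mxE.
have quad s : 0 <= s ^+ 2 * X i i + 2 * s * X i j + X j j.
  have := Xpsd (s *: delta_mx i 0 + delta_mx j 0).
  have -> : (s *: delta_mx i 0 + delta_mx j 0)^T =
      s *: delta_mx 0 i + delta_mx 0 j :> 'M[R]_(1, N).
    by apply/matrixP => k l; rewrite !mxE ![_ && (k == 0)]andbC.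
  rewrite !mulmxDl !mulmxDr -!scalemxAl -!scalemxAr.
  rewrite mxE [X in X + _]mxE [X in _ + X]mxE.
  have scaleE (c : R) (M : 'M[R]_1) : (c *: M) 0 0 = c * M 0 0 by rewrite mxE.
  rewrite !scaleE !entryE Xji; congr (0 <= _); ring.
have [Xii0|Xii_neq0] := eqVneq (X i i) 0.
  have [->|Xij_neq0] := eqVneq (X i j) 0; first by rewrite Xii0 mul0r expr0n.
  (* With X i i = 0 the form is affine in s; this s makes it equal to -1. *)
  have := quad (- (X j j + 1) / (2 * X i j)).
  rewrite Xii0 mulr0 add0r.
  have -> : 2 * (- (X j j + 1) / (2 * X i j)) * X i j + X j j = -1 by field.
  by rewrite ler0N1.
have Xii_gt0 : 0 < X i i by rewrite lt_def Xii_neq0 psd_diag_ge0.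
(* The minimizer of the quadratic in s. *)
have := quad (- X i j / X i i).
have -> : (- X i j / X i i) ^+ 2 * X i i + 2 * (- X i j / X i i) * X i j + X j j
   = (X i i * X j j - X i j ^+ 2) / X i i by field.
by rewrite pmulr_lge0 ?invr_gt0// subr_ge0.
Qed.

Lemma psd_gram N k (B : 'M[R]_(N, k)) : psd (B *m B^T).
Proof.
move=> v; rewrite !mulmxA -mulmxA -[B^T *m v]trmxK trmx_mul trmxK.
rewrite mxE; apply: sumr_ge0 => j _.
by rewrite [_^T j 0]mxE -expr2 sqr_ge0.
Qed.

(** Cholesky factorization by induction on the size, through the Schur
    complement D of the top left entry a.  The case a = 0 needs no separate
    treatment: the first column b then vanishes by [psd_minor], and the
    convention 0^-1 = 0 makes D the lower right block. *)
Lemma psd_factor N (X : 'M[R]_N) :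
  X^T = X -> psd X -> exists B : 'M[R]_N, X = B *m B^T.
Proof.
elim: N X => [X _ _|N IH X XT Xpsd].
  by exists 0; apply/matrixP => -[].
change (N.+1) with (1 + N)%N in X, XT, Xpsd |- *.
pose a := X (lshift N 0) (lshift N 0); pose b := dlsubmx X.
have a_ge0 : 0 <= a by exact: psd_diag_ge0.
have XE : X = block_mx a%:M b^T b (drsubmx X).
  rewrite -[LHS]submxK; congr block_mx.
    by rewrite [LHS]mx11_scalar !mxE.
  by rewrite /b trmx_dlsub XT.
have b0 : a = 0 -> b = 0.
  move=> a0; apply/matrixP => i j; rewrite !mxE ord1.
  have := psd_minor (lshift N 0) (rshift 1 i) XT Xpsd.
  rewrite -/a a0 mul0r -[in X in X ^+ 2 <= _]XT mxE => Xb.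
  by apply/eqP; rewrite -sqrf_eq0 eq_le Xb sqr_ge0.
pose D := drsubmx X - a^-1 *: (b *m b^T).
have DT : D^T = D.
  by rewrite /D linearB /= linearZ /= trmx_mul trmxK trmx_drsub XT.
have Dpsd : psd D.
  (* The form of D at w is that of X at w extended by the first coordinate
     which minimizes it. *)
  move=> w; pose c := (b^T *m w) 0 0.
  have cE : b^T *m w = c%:M by rewrite [LHS]mx11_scalar.
  have cET : w^T *m b = c%:M.
    by rewrite -[LHS]trmxK trmx_mul trmxK cE tr_scalar_mx.
  have scaleE (d : R) (M : 'M[R]_1) : (d *: M) 0 0 = d * M 0 0 by rewrite mxE.
  have := Xpsd (col_mx (- a^-1 * c)%:M w).
  rewrite [in X in X -> _]XE tr_col_mx mul_row_block mul_row_col tr_scalar_mx.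
  rewrite !mulmxDl -!mulmxA.
  rewrite /D mulmxBl mulmxBr -scalemxAl -scalemxAr -(mulmxA b).
  rewrite ![w^T *m (b *m _)]mulmxA cET cE -!scalar_mxM scale_scalar_mx.
  have addE (M P : 'M[R]_1) : (M + P) 0 0 = M 0 0 + P 0 0 by rewrite mxE.
  have oppE (M : 'M[R]_1) : (- M) 0 0 = - M 0 0 by rewrite mxE.
  have scalarE d : (d%:M : 'M[R]_1) 0 0 = d by rewrite mxE.
  have aaV : a * a^-1 ^+ 2 = a^-1.
    have [->|a_neq0] := eqVneq a 0; first by rewrite invr0 mul0r.
    by field.
  rewrite !addE oppE !scalarE; congr (0 <= _); ring: aaV.
have [D' DE] := IH D DT Dpsd.
exists (block_mx (Num.sqrt a)%:M 0 ((Num.sqrt a)^-1 *: b) D').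
rewrite [LHS]XE tr_block_mx mulmx_block !trmx0 !mul0mx !mulmx0 !addr0.
rewrite tr_scalar_mx -scalar_mxM -expr2 sqr_sqrtr//.
have sqrtK : (Num.sqrt a * (Num.sqrt a)^-1) *: b = b.
  have [a0|a_neq0] := eqVneq a 0; first by rewrite b0// scaler0.
  by rewrite divff ?scale1r// gt_eqF// sqrtr_gt0 lt_def a_neq0.
congr block_mx.
- by rewrite linearZ /= mul_scalar_mx scalerA -linearZ /= sqrtK.
- by rewrite mul_mx_scalar scalerA sqrtK.
- rewrite -DE linearZ /= -scalemxAl -scalemxAr scalerA -invfM -expr2 sqr_sqrtr//.
  by rewrite /D addrC subrK.
Qed.

End Psd.

(** * The max-norm ball as a projection of the spectrahedron *)

Section MaxNorm.
Context {R : realType}.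

Lemma norm2oo_ge0 m k (L : 'M[R]_(m, k)) : 0 <= norm2oo L.
Proof. by apply/bigmax_geP; left. Qed.

Lemma norm2oo_sqr_leP m k (L : 'M[R]_(m, k)) c : 0 <= c ->
  (forall i, (L *m L^T) i i <= c) <-> norm2oo L ^+ 2 <= c.
Proof.
move=> c_ge0.
have gramE i : (L *m L^T) i i = \sum_j L i j ^+ 2.
  by rewrite mxE; apply: eq_bigr => j _; rewrite mxE expr2.
have sum_ge0 i : 0 <= \sum_j L i j ^+ 2.
  by apply: sumr_ge0 => j _; exact: sqr_ge0.
rewrite -(sqr_sqrtr c_ge0) ler_sqr ?nnegrE ?norm2oo_ge0 ?sqrtr_ge0//.
split=> [Lc|/bigmax_leP[_ Lc] i].
  apply: bigmax_le => [|i _]; first exact: sqrtr_ge0.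
  by rewrite ler_sqrt// -gramE -[leRHS](sqr_sqrtr c_ge0).
by rewrite sqr_sqrtr// gramE -ler_sqrt// Lc.
Qed.

Lemma max_norm_values_ge0 m n (Z : 'M[R]_(m, n)) :
  lbound [set c | exists (k : nat) (L : 'M[R]_(m, k)) (P : 'M[R]_(n, k)),
            L *m P^T = Z /\ c = Num.max (norm2oo L ^+ 2) (norm2oo P ^+ 2)] 0.
Proof. by move=> _ [k [L [P [_ ->]]]]; rewrite le_max sqr_ge0. Qed.

(** Cutting a square factor of t X into its first m and last n rows factors the
    upper right block; the diagonal of t X bounds the squared row norms. *)
Lemma boxplus_max_norm_ball m n (t : R) (X : 'M[R]_(m + n)) :
  0 <= t -> boxplus X -> max_norm_ball m n t (ursubmx (t *: X)).
Proof.
move=> t_ge0 [XT Xpsd Xdiag].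
have [B XE] := psd_factor XT Xpsd.
pose C := Num.sqrt t *: B.
have CE : t *: X = C *m C^T.
  by rewrite XE linearZ /= -scalemxAl -scalemxAr scalerA -expr2 sqr_sqrtr.
have Cdiag i : (C *m C^T) i i <= t.
  by rewrite -CE mxE -[leRHS]mulr1 ler_wpM2l.
have blockE : C *m C^T = block_mx (usubmx C *m (usubmx C)^T)
    (usubmx C *m (dsubmx C)^T) (dsubmx C *m (usubmx C)^T)
    (dsubmx C *m (dsubmx C)^T).
  by rewrite -mul_col_row -tr_col_mx vsubmxK.
rewrite /max_norm_ball /= CE; apply: (@le_trans _ _
    (Num.max (norm2oo (usubmx C) ^+ 2) (norm2oo (dsubmx C) ^+ 2))).
  apply: ge_inf; first by exists 0; exact: max_norm_values_ge0.
  by exists (m + n)%N, (usubmx C), (dsubmx C); split; rewrite // blockE block_mxKur.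
rewrite ge_max; apply/andP; split; apply/norm2oo_sqr_leP => // i.
  by have := Cdiag (lshift n i); rewrite blockE block_mxEul.
by have := Cdiag (rshift m i); rewrite blockE block_mxEdr.
Qed.

(** The strict inequality supplies a factorization without having to know that
    the infimum in the max-norm is attained. *)
Lemma max_norm_lt_boxplus m n (u : R) (Z : 'M[R]_(m, n)) :
  max_norm Z < u -> exists2 X, boxplus X & Z = ursubmx (u *: X).
Proof.
move=> Zu.
have [|_ [k [L [P [ZE ->]]]] cu] := inf_lt _ Zu.
  by eexists; exists n, Z, 1%:M; rewrite trmx1 mulmx1.
have u_gt0 : 0 < u by apply: le_lt_trans cu; rewrite le_max sqr_ge0.
have [u_ge0 u_neq0] : 0 <= u /\ u != 0 by rewrite ltW// gt_eqF.
move: cu; rewrite gt_max => /andP[/ltW Lu /ltW Pu].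
have {}Lu := (norm2oo_sqr_leP L u_ge0).2 Lu.
have {}Pu := (norm2oo_sqr_leP P u_ge0).2 Pu.
pose C := col_mx L P.
exists (u^-1 *: (C *m C^T)); last first.
  by rewrite scalerA divff// scale1r tr_col_mx mul_col_row block_mxKur.
split=> [|v|i].
- by rewrite linearZ /= trmx_mul trmxK.
- rewrite -scalemxAr -scalemxAl mxE mulr_ge0 ?invr_ge0//.
  exact: psd_gram.
- rewrite mxE mulrC ler_pdivrMr// mul1r tr_col_mx mul_col_row.
  by case: (split_ordP i) => j ->; rewrite ?block_mxEul ?block_mxEdr.
Qed.

Lemma boxplus_rank1 N (v : 'cV[R]_N) :
  Num.sqrt (\sum_i v i 0 ^+ 2) = 1 -> boxplus (v *m v^T).
Proof.
move=> v1; split=> [| |i]; first by rewrite trmx_mul trmxK.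
  exact: psd_gram.
rewrite mxE big_ord1 mxE -expr2.
have s_ge0 : 0 <= \sum_i v i 0 ^+ 2 by apply: sumr_ge0 => j _; exact: sqr_ge0.
rewrite -[leRHS](expr1n _ 2) -v1 sqr_sqrtr// (bigD1 i)//= lerDl.
by apply: sumr_ge0 => j _; exact: sqr_ge0.
Qed.

Lemma boxplus_segment N (X S : 'M[R]_N) a :
  0 <= a <= 1 -> boxplus X -> boxplus S -> boxplus (X + a *: (S - X)).
Proof.
move=> /andP[a_ge0 a_le1] [XT Xpsd Xd] [ST Spsd Sd].
have -> : X + a *: (S - X) = (1 - a) *: X + a *: S.
  by rewrite scalerBl scalerBr scale1r addrA addrAC.
have a'_ge0 : 0 <= 1 - a by rewrite subr_ge0.
split=> [|v|i].
- by rewrite linearD /= !linearZ /= XT ST.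
- rewrite mulmxDr mulmxDl -!scalemxAr -!scalemxAl mxE [X in X + _]mxE.
  by rewrite [X in _ + X]mxE addr_ge0// mulr_ge0.
- rewrite !mxE; have := Xd i; have := Sd i; nra.
Qed.

Lemma boxplus_entry N (X : 'M[R]_N) i j : boxplus X -> `|X i j| <= 1.
Proof.
move=> [XT Xpsd Xd].
rewrite -(ler_sqr (normr_ge0 _) ler01) real_normK ?num_real// expr1n.
rewrite (le_trans (psd_minor i j XT Xpsd))//.
by rewrite mulr_ile1// ?psd_diag_ge0.
Qed.

(** Ensures that the infimum in the oracle condition is a lower bound for the
    values of the linearized objective. *)
Lemma frob_boxplus_has_lbound N (G : 'M[R]_N) :
  has_lbound [set frob Y G | Y in boxplus].
Proof.
exists (- \sum_i \sum_j `|G j i|) => _ [Y Ybox <-].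
rewrite /frob /mxtrace -sumrN; apply: ler_sum => i _.
rewrite mxE -sumrN; apply: ler_sum => j _; rewrite mxE.
have : `|Y j i * G j i| <= `|G j i|.
  by rewrite normrM ler_piMl// boxplus_entry.
by rewrite ler_norml => /andP[].
Qed.

End MaxNorm.

(** * First-order convexity *)

Section FirstOrder.
Context {R : realType}.

Lemma convex_function_segment (V : lmodType R) (f : V -> R) x y a :
  convex_function setT f -> 0 <= a <= 1 ->
  f (x + a *: (y - x)) <= f x + a * (f y - f x).
Proof.
move=> fconv a01.
have /andP[a_ge0 a_le1] := a01.
have itv01 : Itv.spec (@Itv.num_sem R) (Itv.Real `[0%Z, 1%Z]) a.
  by rewrite /Itv.spec /Itv.num_sem /= num_real in_itv/= a01.
have : f (a *: y + (1 - a) *: x) <= a * f y + (1 - a) * f x.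
  exact: (fconv (Itv.mk itv01) y x (in_setT _) (in_setT _)).
have -> : a *: y + (1 - a) *: x = x + a *: (y - x).
  by rewrite scalerBl scalerBr scale1r addrCA addrA.
by move/le_trans; apply; rewrite le_eqVlt; apply/orP; left; apply/eqP; ring.
Qed.

(** It suffices to control the difference quotient for small positive steps,
    since the two-sided limit is also the limit from the right. *)
Lemma derive_le_increment (V : normedModType R) (F : V -> R) x v c :
  derivable F x v ->
  (forall a, 0 < a <= 1 -> F (x + a *: v) <= F x + a * c) ->
  'D_v F x <= c.
Proof.
move=> dF Fle.
have := cvg_dnbhs_at_right dF.
move=> /cvgr_to_le; apply.
near=> h.
have h_gt0 : 0 < h by near: h; exact: nbhs_right_gt.
have h_le1 : h <= 1 by near: h; exact: nbhs_right_le.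
rewrite /= [_ *: _]mulrC ler_pdivrMr// mulrC lerBlDl addrC.
by apply: Fle; rewrite h_gt0.
Unshelve. all: by end_near. Qed.

End FirstOrder.

(** * Conditional gradient descent with an approximate linear oracle *)

Section FrankWolfe.
Context {R : realType}.

(** The first step has a = 1, so it forgets the starting value and already
    yields 2 C.  The induction step rests on (x - 1) (x + 1) <= x^2, with x = k + 3. *)
Lemma harmonic_rate (h : nat -> R) C : 0 <= C ->
  (forall k, let a := 2 / k.+2%:R in
     h k.+1 <= (1 - a) * h k + 2 * a ^+ 2 * C) ->
  forall k, h k.+1 <= 8 * C / k.+3%:R.
Proof.
move=> C_ge0 hrec; elim=> [|k IH]; apply: (le_trans (hrec _)).
  rewrite divff// subrr mul0r add0r; lra.
set x : R := k.+3%:R in IH *; have x_gt0 : 0 < x by rewrite ltr0n.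
have x_ge3 : 3 <= x by rewrite ler_nat.
have -> : k.+4%:R = x + 1 :> R by rewrite -natr1.
have a_ge0 : 0 <= 1 - 2 / x by rewrite subr_ge0 ler_pdivrMr//; lra.
apply: le_trans (_ : (1 - 2 / x) * (8 * C / x) + 2 * (2 / x) ^+ 2 * C <= _).
  by rewrite lerD2r ler_wpM2l.
have -> : (1 - 2 / x) * (8 * C / x) + 2 * (2 / x) ^+ 2 * C =
    8 * C / (x + 1) - 8 * C / (x ^+ 2 * (x + 1)) by field; lra.
rewrite gerBl divr_ge0 ?mulr_ge0 ?sqr_ge0//; lra.
Qed.

Lemma curvature_step N (F : 'M[R]_N -> R) (X S : 'M[R]_N) a C :
  curvature F = C%:E -> boxplus X -> boxplus S -> 0 < a <= 1 ->
  F (X + a *: (S - X)) <=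
    F X + a * frob (S - X) (sym_grad F X) + a ^+ 2 * C.
Proof.
move=> CE Xbox Sbox a01; have /andP[a_gt0 _] := a01.
pose q := (a ^+ 2)^-1 * (F (X + a *: (S - X)) - F X -
  frob (X + a *: (S - X) - X) (sym_grad F X)).
have : (q%:E <= C%:E)%E.
  by rewrite -CE; apply: ereal_sup_ubound; exists X, S, (X + a *: (S - X)), a.
rewrite lee_fin /q mulrC ler_pdivrMr ?exprn_gt0// addrAC [X + _]addrC addrK.
have -> : frob (a *: (S - X)) (sym_grad F X) = a * frob (S - X) (sym_grad F X).
  by rewrite /frob linearZ /= -scalemxAl mxtraceZ.
by lra.
Qed.

Lemma lift_obj_differentiable m n (f : 'M[R]_(m, n) -> R) t X :
  (forall Z, differentiable f Z) -> differentiable (lift_obj f t) X.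
Proof.
move=> fdiff.
have cont : continuous (usubmx : 'M[R]_(m + n) -> 'M[R]_(m, m + n)).
  move=> u A /nbhs_ballP[e /= e0 eA].
  apply/nbhs_ballP; exists e => //= v [_ uv]; apply: eA; split=> // i j.
  by apply: le_lt_trans (uv (lshift n i) j); rewrite !mxE.
rewrite (_ : lift_obj f t = f \o (rsubmx \o (usubmx \o *:%R t)))//.
apply: differentiable_comp => //.
apply: differentiable_comp; last exact: differentiable_rsubmx.
apply: differentiable_comp; last exact: linear_differentiable.
exact/linear_differentiable/scaler_continuous.
Qed.

Lemma lift_obj_segment m n (f : 'M[R]_(m, n) -> R) t X Y a :
  convex_function setT f -> 0 <= a <= 1 ->
  lift_obj f t (X + a *: (Y - X)) <=
    lift_obj f t X + a * (lift_obj f t Y - lift_obj f t X).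
Proof.
move=> fconv a01; rewrite /lift_obj.
have -> : ursubmx (t *: (X + a *: (Y - X))) = ursubmx (t *: X) +
    a *: (ursubmx (t *: Y) - ursubmx (t *: X)).
  by apply/matrixP => i j; rewrite !mxE; ring.
exact: convex_function_segment.
Qed.

(** The gradient inequality of a convex function, in the symmetric matrices,
    where [sym_grad] represents the derivative. *)
Lemma lift_obj_first_order m n (f : 'M[R]_(m, n) -> R) t X Y :
  (forall Z, differentiable f Z) -> convex_function setT f ->
  X^T = X -> Y^T = Y ->
  frob (Y - X) (sym_grad (lift_obj f t) X) <= lift_obj f t Y - lift_obj f t X.
Proof.
move=> fdiff fconv XT YT; have Fdiff := lift_obj_differentiable t X fdiff.
rewrite sym_gradP//; last by rewrite linearB /= XT YT.
apply: derive_le_increment => [|a /andP[a_gt0 a_le1]].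
  exact: diff_derivable.
by apply: lift_obj_segment => //; rewrite ltW.
Qed.

Lemma frobBl p q (A B G : 'M[R]_(p, q)) :
  frob (A - B) G = frob A G - frob B G.
Proof. by rewrite /frob !linearB /= mulmxBl linearB. Qed.

Lemma solver_run_boxplus m n (f : 'M[R]_(m, n) -> R) t C X S k :
  solver_run f t C X S -> boxplus (X k).
Proof.
move=> [[v [v1 X0]] run]; elim: k => [|k IH].
  by rewrite X0; exact: boxplus_rank1.
have [Sbox _ ->] := run k.
apply: boxplus_segment => //.
by rewrite divr_ge0//= ler_pdivrMr// mul1r ler_nat.
Qed.

(** Any competitor in boxplus is allowed, so no minimizer need exist. *)
Lemma solver_run_gap m n (f : 'M[R]_(m, n) -> R) t C X S Y k :
  (forall Z, differentiable f Z) -> convex_function setT f ->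
  curvature (lift_obj f t) = C%:E -> 0 <= C -> solver_run f t C X S ->
  boxplus Y ->
  lift_obj f t (X k.+1) - lift_obj f t Y <= 8 * C / k.+3%:R.
Proof.
move=> fdiff fconv CE C_ge0 run Ybox.
apply: (harmonic_rate (h := fun k => lift_obj f t (X k) - lift_obj f t Y)) => //.
move=> {}k /=; set a := 2 / _.
have a_gt0 : 0 < a by rewrite divr_gt0.
have a01 : 0 < a <= 1 by rewrite a_gt0 ler_pdivrMr// mul1r ler_nat.
have Xbox := solver_run_boxplus k run.
have [Sbox Sopt ->] := run.2 k; rewrite -/a in Sopt *.
have step := curvature_step CE Xbox Sbox a01.
have {}Sopt : frob (S k) (sym_grad (lift_obj f t) (X k)) <=
    frob Y (sym_grad (lift_obj f t) (X k)) + a * C.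
  apply: (le_trans Sopt); rewrite lerD2r.
  by apply: ge_inf; [exact: frob_boxplus_has_lbound|exists Y].
have [[XT _ _] [YT _ _]] := (Xbox, Ybox).
have := lift_obj_first_order t fdiff fconv XT YT.
move: step Sopt; rewrite !frobBl; nra.
Qed.

End FrankWolfe.

Theorem corollary33 (R : realType) (m n : nat) (f : 'M[R]_(m, n) -> R)
    (t eps Cf : R) (X S : nat -> 'M[R]_(m + n))
    (f_diff : forall Z, differentiable f Z)
    (f_convex : convex_function setT f)
    (t_gt0 : 0 < t) (eps_gt0 : 0 < eps)
    (Cf_def : curvature (lift_obj f t) = Cf%:E) (Cf_gt0 : 0 < Cf)
    (run : solver_run f t Cf X S) :
  let K := `|Num.ceil (8 * Cf / eps)|%N in
  let Z := ursubmx (t *: X K) in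
  max_norm_ball m n t Z /\
  f Z <= inf [set f Z' | Z' in max_norm_ball m n t] + eps.
Proof.
move=> K Z.
have C_ge0 : 0 <= Cf := ltW Cf_gt0.
have opt X' : boxplus X' -> f Z <= lift_obj f t X' + eps.
  have K_ge : 8 * Cf / eps <= K%:R.
    rewrite natr_absz ger0_norm ?ceil_ge//.
    by rewrite ceil_ge0 (lt_le_trans _ (divr_ge0 _ _)) ?mulr_ge0// ?ltW.
  have K_gt0 : (0 < K)%N.
    by rewrite -(ltr_nat R) (lt_le_trans _ K_ge)// divr_gt0 ?mulr_gt0.
  move=> X'box; rewrite -lerBlDl -/(lift_obj f t (X K)).
  have := solver_run_gap K.-1 f_diff f_convex Cf_def C_ge0 run X'box.
  rewrite prednK// => /le_trans; apply.
  rewrite ler_pdivrMr// [eps * _]mulrC -ler_pdivrMr// (le_trans K_ge)// ler_nat.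
  by rewrite -addn2 leq_addr.
have Zball : max_norm_ball m n t Z.
  exact: boxplus_max_norm_ball (ltW t_gt0) (solver_run_boxplus K run).
split=> //.
rewrite -lerBlDr; apply: lb_le_inf => [|_ [Z' Z'ball <-]].
  by exists (f Z), Z.
rewrite lerBlDr; apply/ler_addgt0Pr => e e_gt0.
set d := f 0 - f Z'.
(* A shrinking ratio 1 - a, with a small enough that a * d <= e and, thanks
   to the summand 1, with a < 1 even when d = 0. *)
pose a := e / (`|d| + e + 1).
have de_gt0 : 0 < `|d| + e + 1 by rewrite ltr_wpDl// addr_ge0// ltW.
have a_gt0 : 0 < a by rewrite divr_gt0.
have a_lt1 : a < 1.
  by rewrite ltr_pdivrMr// mul1r; have := normr_ge0 d; lra.
have ad_le : a * d <= e.
  by rewrite mulrAC ler_pdivrMr// ler_pM2l//; have := ler_norm d; lra.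
have s_gt0 : 0 < 1 - a by rewrite subr_gt0.
have [|X' X'box Z'E] := @max_norm_lt_boxplus R m n (t / (1 - a)) Z'.
  by apply: le_lt_trans Z'ball _; rewrite ltr_pdivlMr// gtr_pMr// gtrBl.
apply: (le_trans (opt X' X'box)); rewrite addrAC lerD2r.
have -> : lift_obj f t X' = f (Z' + a *: (0 - Z')).
  congr (f _); rewrite sub0r scalerN -[X in X - _]scale1r -scalerBl Z'E.
  by apply/matrixP => i j; rewrite !mxE; field; rewrite gt_eqF.
apply: (le_trans (convex_function_segment _ _ f_convex _)).
  by rewrite !ltW.
by rewrite lerD2l.
Qed.
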